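(* Let $X$ and $A$ be nonempty sets and let $F\colon A\to\mathcal P(X)$ be a soft set with $F(t)\neq\varnothing$ for every $t\in A$ and $\mathrm{SE}(F)\neq\varnothing$. Let $(F,\tau_1,\tau_2)$ be a canonical soft bitopological space. If a soft subset $H\subseteq_s F$ is pairwise soft compact, then for every $t\in A$ the set $H(t)$ is pairwise compact in the component bitopological space $(F(t),(\tau_1)_t,(\tau_2)_t)$.
   Context: A soft set over $X$ with parameter set $A$ is a map $H\colon A\to\mathcal P(X)$; it is a soft subset of $F$, written $H\subseteq_s F$, if $H(t)\subseteq F(t)$ for every $t\in A$. Soft unions (arbitrary) and soft intersections (finite) are taken pointwise in $t$. The null soft set $\Phi$ is $\Phi(t)=\varnothing$ for all $t\in A$. $\mathrm{SE}(F)$ is the set of maps $a\colon A\to X$ with $a(t)\in F(t)$ for every $t\in A$. A soft topology on $F$ is a family $\tau$ of soft subsets of $F$ with $\Phi,F\in\tau$, closed under arbitrary soft unions and finite soft intersections. Its component topology at $t\in A$ is $\tau_t=\{H(t):H\in\tau\}$, which is a topology on $F(t)$. The soft topology $\tau$ is canonical if $\tau=\{H\subseteq_s F:H(t)\in\tau_t\text{ for every }t\in A\}$. A soft bitopological space is a triple $(F,\tau_1,\tau_2)$ with $\tau_1,\tau_2$ soft topologies on $F$; it is canonical if both $\tau_1,\tau_2$ are canonical. For $H\subseteq_s F$, a pairwise soft open cover of $H$ is a family $\mathcal C\subseteq\tau_1\cup\tau_2$ with $H(t)\subseteq\bigcup_{C\in\mathcal C}C(t)$ for every $t\in A$. $H$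 is pairwise soft compact if every pairwise soft open cover of $H$ has a finite subfamily that is still a pairwise soft open cover of $H$. For a bitopological space $(Y,\sigma_1,\sigma_2)$ (two topologies on a set $Y$) and $B\subseteq Y$, a pairwise open cover of $B$ is a family $\mathcal V\subseteq\sigma_1\cup\sigma_2$ with $B\subseteq\bigcup_{V\in\mathcal V}V$ (it may consist only of sets from one of the topologies). $B$ is pairwise compact if every pairwise open cover of $B$ has a finite subfamily that covers $B$. *)

(* Defs.v *)
From mathcomp Require Import all_boot.
From mathcomp Require Import classical_sets cardinality.

Set Implicit Arguments.
Unset Strict Implicit.
Unset Printing Implicit Defensive.

Local Open Scope classical_set_scope.

Section Bitopology.
Context {X : Type}.

(* A topology on a subset Y of X is kept as a family of subsets of X, all of
   them included in Y, rather than as a structure on a subtype.  Closure under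
   binary intersections gives nonempty finite ones by induction, and the empty
   one is [topology_total]. *)
Record topology (Y : set X) := Topology {
  opens :> set (set X);
  topology_sub : forall U, opens U -> U `<=` Y;
  topology_empty : opens set0;
  topology_total : opens Y;
  topology_bigcup : forall V : set (set X),
    V `<=` opens -> opens (\bigcup_(U in V) U);
  topology_cap : forall U V, opens U -> opens V -> opens (U `&` V)
}.

Record bitopology (Y : set X) := Bitopology {
  top1 : topology Y;
  top2 : topology Y
}.

Definition pairwise_open_cover {Y : set X} (S : bitopology Y) (B : set X)
    (V : set (set X)) : Prop :=
  V `<=` top1 S `|` top2 S /\ B `<=` \bigcup_(U in V) U.

Definition pairwise_compact {Y : set X} (S : bitopology Y) (B : set X) : Prop :=
  forall V : set (set X), pairwise_open_cover S B V ->
  exists W : set (set X),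
    [/\ W `<=` V, finite_set W & B `<=` \bigcup_(U in W) U].

End Bitopology.

Definition soft_set (A X : Type) : Type := A -> set X.

Section SoftSets.
Context {A X : Type}.
Implicit Types (F H K : soft_set A X) (C D : set (soft_set A X)).

Definition soft_subset H F : Prop := forall t, H t `<=` F t.

Definition soft_null : soft_set A X := fun=> set0.

Definition soft_bigcup C : soft_set A X := fun t => \bigcup_(K in C) K t.

Definition soft_cap H K : soft_set A X := fun t => H t `&` K t.

Definition SE F : set (A -> X) := [set a | forall t, F t (a t)].

Record soft_topology F := SoftTopology {
  soft_opens :> set (soft_set A X);
  soft_topology_sub : forall H, soft_opens H -> soft_subset H F;
  soft_topology_null : soft_opens soft_null;
  soft_topology_total : soft_opens F;
  soft_topology_bigcup : forall C,
    C `<=` soft_opens -> soft_opens (soft_bigcup C);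
  soft_topology_cap : forall H K,
    soft_opens H -> soft_opens K -> soft_opens (soft_cap H K)
}.

Definition component_opens {F} (tau : soft_topology F) (t : A) : set (set X) :=
  [set H t | H in soft_opens tau].

Section Component.
Context {F : soft_set A X} (tau : soft_topology F) (t : A).

Lemma component_sub U : component_opens tau t U -> U `<=` F t.
Proof. by move=> [H tauH <-]; exact: (soft_topology_sub tauH). Qed.

Lemma component_empty : component_opens tau t set0.
Proof. by exists soft_null => //; exact: soft_topology_null. Qed.

Lemma component_total : component_opens tau t (F t).
Proof. by exists F => //; exact: soft_topology_total. Qed.

Lemma component_bigcup (V : set (set X)) :
  V `<=` component_opens tau t -> component_opens tau t (\bigcup_(U in V) U).
Proof.
move=> sV; pose C : set (soft_set A X) := [set H | soft_opens tau H /\ V (H t)].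
exists (soft_bigcup C); first by apply: soft_topology_bigcup => H [].
apply/seteqP; split=> x.
- by move=> [H [_ VH] Hx]; exists (H t).
- move=> [U VU Ux]; have [H tauH HU] := sV _ VU.
  by exists H; rewrite /C /= ?HU.
Qed.

Lemma component_cap U V : component_opens tau t U -> component_opens tau t V ->
  component_opens tau t (U `&` V).
Proof.
move=> [H tauH <-] [K tauK <-]; exists (soft_cap H K) => //.
exact: soft_topology_cap.
Qed.

Definition component : topology (F t) :=
  Topology component_sub component_empty component_total
    component_bigcup component_cap.

End Component.

Definition canonical {F} (tau : soft_topology F) : Prop :=
  soft_opens tau =
  [set H | soft_subset H F /\ forall t, opens (component tau t) (H t)].

Record soft_bitopology F := SoftBitopology {
  soft_top1 : soft_topology F;
  soft_top2 : soft_topology F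
}.

Definition canonical_bitopology {F} (S : soft_bitopology F) : Prop :=
  canonical (soft_top1 S) /\ canonical (soft_top2 S).

Definition component_bitopology {F} (S : soft_bitopology F) (t : A) :
    bitopology (F t) :=
  Bitopology (component (soft_top1 S) t) (component (soft_top2 S) t).

Definition pairwise_soft_open_cover {F} (S : soft_bitopology F) H C : Prop :=
  C `<=` soft_top1 S `|` soft_top2 S /\
  forall t, H t `<=` \bigcup_(K in C) K t.

Definition pairwise_soft_compact {F} (S : soft_bitopology F) H : Prop :=
  forall C, pairwise_soft_open_cover S H C ->
  exists D, [/\ D `<=` C, finite_set D & pairwise_soft_open_cover S H D].

End SoftSets.

(* Main.v *)
Require Import Defs.
From mathcomp Require Import all_boot.
From mathcomp Require Import boolp classical_sets cardinality.

Local Open Scope classical_set_scope.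

(** Given a pairwise open cover [V] of [H t], take all soft open sets whose
    value at [t] is in [V] or is empty.  By canonicity they include the soft
    set that is empty at [t] and equal to [F] elsewhere, which covers [H] away
    from [t]; it adds nothing at [t], so a finite subcover evaluated at [t]
    yields a finite subcover of [V].  Allowing empty values at [t] makes the
    argument work when [V] is empty. *)

(** Each value is empty or all of [F s], hence open in the component at [s]; canonicity glues these
    into a soft open set. *)
Lemma canonical_soft_set_off {A X : Type} {F : soft_set A X}
    (tau : soft_topology F) (t : A) : Defs.canonical tau ->
  soft_opens tau (fun s => F s `&` [set _ | s <> t]).
Proof.
move=> ->; split=> [s x []//|s /=].
have [->|st] := pselect (s = t).
  suff -> : F t `&` [set _ | t <> t] = set0 by exact: component_empty.
  by apply/seteqP; split=> x // [].
suff -> : F s `&` [set _ | s <> t] = F s by exact: component_total.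
by apply/seteqP; split=> x // [].
Qed.

Theorem theorem5p3 (X A : Type)
    (X_nonempty : inhabited X) (A_nonempty : inhabited A)
    (F : soft_set A X)
    (F_nonempty : forall t : A, F t !=set0)
    (SE_nonempty : SE F !=set0)
    (S : soft_bitopology F) (S_canonical : canonical_bitopology S)
    (H : soft_set A X) (H_sub : soft_subset H F)
    (H_compact : pairwise_soft_compact S H) :
  forall t : A, pairwise_compact (component_bitopology S t) (H t).
Proof.
move=> t V [V_open V_cover].
pose C : set (soft_set A X) :=
  [set K | (soft_top1 S `|` soft_top2 S) K /\ (K t = set0 \/ V (K t))].
have [|D [DC D_finite [_ D_cover]]] := H_compact C.
  split=> [K []//|s x Hx]; have [st|st] := pselect (s = t).
    subst s; have [U VU Ux] := V_cover _ Hx.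
    (* [U] is component-open, so it is the value at [t] of a soft open [K], which then lies in
       [C]. *)
    by case: (V_open _ VU) => -[K tauK KU]; exists K; rewrite /C /= ?KU //;
      split; [left|right|right|right].
  exists (fun s => F s `&` [set _ | s <> t]); last by split=> //; exact: H_sub.
  split; first by left; apply: canonical_soft_set_off; case: S_canonical.
  by left; apply/seteqP; split=> y // [].
(* Values at [t] of members of [D] may be empty and outside [V]; intersecting with [V] drops only
   these, so no point is lost. *)
exists ([set K t | K in D] `&` V); split=> [U []//| |x Hx].
  by apply: finite_setIl; exact: finite_image.
have [K DK Kx] := D_cover _ _ Hx; exists (K t) => //; split; first by exists K.
by have [_ [K0|//]] := DC _ DK; rewrite K0 in Kx.
Qed.
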